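(* Assume that each $f_i:\mathbb{R}^d\to\mathbb{R}$ ($i=1,\dots,N$) is $L$-smooth and that $f$ satisfies the restricted-secant inequality: $f$ is continuously differentiable and there is $\mu>0$ such that $\langle\nabla f(x),x-x^\star\rangle\ge\frac\mu2\|x-x^\star\|^2$ for all $x\in\mathbb{R}^d$. Let $m\ge1$ be an integer and choose the sawtooth staleness $\xi_k=k-m\lfloor k/m\rfloor$ (so that the pivot used at iterations $jm\le k<(j+1)m$ is $x_{jm}$). Let $\{x_k\}_{k\ge0}$ be generated from $x_0$ by SGD with the variance-reduced gradient estimator, with constant learning rate $h>0$ and mini-batch size $1$, and with additional jumps at times $(jm)_{j\in\mathbb{N}}$: $x_{(j+1)m}$ is picked uniformly in $\{x_k\}_{jm\le k<(j+1)m}$. Then $$\mathbb{E}\left[\|x_{jm}-x^\star\|^2\right]\le\left(\frac{1+2L^2h^2m}{hm(\mu-2L^2h)}\right)^j\|x_0-x^\star\|^2 .$$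
   Context: $f_1,\dots,f_N:\mathbb{R}^d\to\mathbb{R}$ are continuously differentiable, $f:=\frac1N\sum_{i=1}^Nf_i$, and $x^\star\in\mathbb{R}^d$ is the global minimizer of $f$. A differentiable function $g$ is $L$-smooth if $\|\nabla g(x)-\nabla g(y)\|\le L\|x-y\|$ for all $x,y$. The algorithm is as follows. For $jm\le k<(j+1)m$, the update is $$x_{k+1}=x_k-h\bigl(\nabla f_{i_k}(x_k)-\nabla f_{i_k}(x_{jm})+\nabla f(x_{jm})\bigr),$$ where $i_k$ is sampled uniformly from $\{1,\dots,N\}$ independently of the past. At the end of the epoch the value produced for index $(j+1)m$ is discarded and $x_{(j+1)m}$ is redefined to be $x_{\hat r}$, with $\hat r$ picked uniformly at random from $\{jm,\dots,(j+1)m-1\}$.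
   Formalization: The formal theorem additionally assumes 2L²h < μ, so that the denominator hm(μ−2L²h) is positive; for larger h the bound as stated is undefined or, at j = 1 with x₀ ≠ x*, has a negative right-hand side and fails. *)

(* Defs.v *)
From HB Require Import structures.
From mathcomp Require Import all_boot all_order all_algebra finmap.
From mathcomp Require Import all_classical all_reals all_analysis.
Import Order.TTheory GRing.Theory Num.Theory.
Import numFieldNormedType.Exports.

Set Implicit Arguments.
Unset Strict Implicit.
Unset Printing Implicit Defensive.

Local Open Scope classical_set_scope.
Local Open Scope ring_scope.

(* The library norm `|u| on row vectors is the sup norm; the Euclidean one is
   needed here. *)
Definition dot (R : realType) (d : nat) (u v : 'rV[R]_d) : R :=
  \sum_(i < d) u 0 i * v 0 i.

Definition l2norm (R : realType) (d : nat) (u : 'rV[R]_d) : R :=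
  Num.sqrt (dot u u).

Definition grad (R : realType) (d : nat) (g : 'rV[R]_d -> R) (x : 'rV[R]_d) :
    'rV[R]_d :=
  \row_(i < d) 'D_(delta_mx 0 i) g x.

Definition continuously_differentiable (R : realType) (d : nat)
    (g : 'rV[R]_d -> R) : Prop :=
  (forall x, differentiable g x) /\ continuous (grad g).

Definition smooth (R : realType) (d : nat) (L : R) (g : 'rV[R]_d -> R) : Prop :=
  (forall x, differentiable g x) /\
  (forall x y, l2norm (grad g x - grad g y) <= L * l2norm (x - y)).

Definition global_minimizer (R : realType) (d : nat) (g : 'rV[R]_d -> R)
    (xs : 'rV[R]_d) : Prop :=
  forall x, g xs <= g x.

Definition restricted_secant (R : realType) (d : nat) (mu : R)
    (g : 'rV[R]_d -> R) (xs : 'rV[R]_d) : Prop :=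
  [/\ continuously_differentiable g, 0 < mu &
      forall x, mu / 2 * l2norm (x - xs) ^+ 2 <= dot (grad g x) (x - xs)].

Definition favg (R : realType) (d N : nat) (f : 'I_N -> 'rV[R]_d -> R)
    (x : 'rV[R]_d) : R :=
  N%:R^-1 * \sum_(i < N) f i x.

Definition staleness (m k : nat) : nat := (k - m * (k %/ m))%N.

(* x is the current iterate and p the pivot. *)
Definition vr_estimator (R : realType) (d N : nat) (f : 'I_N -> 'rV[R]_d -> R)
    (i : 'I_N) (x p : 'rV[R]_d) : 'rV[R]_d :=
  grad (f i) x - grad (f i) p + grad (favg f) p.

(* The step landing on a multiple of m is discarded by the algorithm, so the
   recursion is imposed only when m does not divide k.+1; at (j.+1 * m) the
   iterate is instead the one of index j * m + r j of the epoch just ended. *)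
Definition svrg_process (R : realType) (d N m : nat) (T : Type)
    (f : 'I_N -> 'rV[R]_d -> R) (h : R) (x0 : 'rV[R]_d)
    (i : nat -> T -> 'I_N) (r : nat -> T -> 'I_m)
    (x : nat -> T -> 'rV[R]_d) : Prop :=
  [/\ forall w, x 0%N w = x0,
      forall (k : nat) (w : T), ~~ (m %| k.+1)%N ->
        x k.+1 w =
        x k w - h *: vr_estimator f (i k w) (x k w) (x (k - staleness m k)%N w)
    & forall (j : nat) (w : T),
        x (j.+1 * m)%N w = x (j * m + r j w)%N w].

(* Draws take values in a finite type carrying its discrete sigma-algebra. *)
Definition generated_sigma (T : Type) (V : finType) (X : T -> V) : set (set T) :=
  preimage_set_system setT X (@discrete_measurable V).

Definition discrete_random_variable (dT : measure_display)
    (T : measurableType dT) (V : finType) (X : T -> V) : Prop :=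
  generated_sigma X `<=` measurable.

Definition uniformly_distributed (dT : measure_display)
    (T : measurableType dT) (R : realType) (P : probability T R)
    (V : finType) (X : T -> V) : Prop :=
  forall a : V, P (X @^-1` [set a]) = (#|V|%:R^-1)%:E.

Definition mutually_independent (dT : measure_display) (T : measurableType dT)
    (R : realType) (P : probability T R) (I : choiceType)
    (E : I -> set (set T)) : Prop :=
  forall (J : {fset I}) (A : I -> set T), (forall s, E s (A s)) ->
    P (\bigcap_(s in [set` J]) A s) = (\prod_(s <- J) P (A s))%E.

(* Every draw is uniform and independent of all earlier ones, which amounts to
   mutual independence of the whole family; inl k indexes the draw made at
   iteration k and inr j the one made at the end of epoch j. *)
Definition svrg_sampling (dT : measure_display) (T : measurableType dT)
    (R : realType) (P : probability T R) (N m : nat)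
    (i : nat -> T -> 'I_N) (r : nat -> T -> 'I_m) : Prop :=
  [/\ forall k, discrete_random_variable (i k) /\ uniformly_distributed P (i k),
      forall j, discrete_random_variable (r j) /\ uniformly_distributed P (r j)
    & mutually_independent P (fun s : nat + nat =>
        match s with
        | inl k => generated_sigma (i k)
        | inr j => generated_sigma (r j)
        end)].

(* Main.v *)
Require Import Defs.
From HB Require Import structures.
From mathcomp Require Import all_boot all_order all_algebra finmap.
From mathcomp Require Import all_classical all_reals all_analysis.
From mathcomp Require Import measurable_realfun.
From mathcomp Require Import ring lra.
Import Order.TTheory GRing.Theory Num.Theory.
Import numFieldNormedType.Exports.

Local Open Scope classical_set_scope.
Local Open Scope ring_scope.

(** Write D for the squared distance to xs, p for the pivot x_(jm) of epoch j,
    and expand D after one update of x_k.  Averaged over the sampled index, the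
    cross term is -2h <grad f(x_k), x_k - xs>, which restricted secant bounds by
    -h mu D(x_k).  The second moment of the estimator is at most
    2 L^2 (D(x_k) + D(p)): splitting it at grad f_l(xs) gives twice the second
    moment of grad f_l(x_k) - grad f_l(xs) plus twice the variance of
    grad f_l(p) - grad f_l(xs), whose mean is grad f(p) because
    grad f(xs) = 0 [grad_favg_xs].  With c = h (mu - 2 L^2 h) and
    b = 2 L^2 h^2 this is [mean_update_le]:
    mean D(x_(k+1)) + c D(x_k) <= D(x_k) + b D(p).

    Taking expectations and summing over the m updates of an epoch, including
    the discarded one, telescopes to c sum_k E D(x_k) <= (1 + b m) E D(p)
    [epoch_sum].  The jump makes E D(x_((j+1)m)) the mean of these m terms
    [expected_jump], hence the contraction factor (1 + b m) / (c m)
    [epoch_contraction].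

    The averaging over a draw is licensed by [expectation_fresh_draw]: the
    iterates are functions of finitely many draws with finitely many values,
    so an expectation is a finite sum over histories, and independence
    factorises the joint law of a history and a later draw. *)

(** * Euclidean inner product *)

Section Dot.
Context {R : realType} {d : nat}.
Implicit Types u v w : 'rV[R]_d.

Lemma dotC u v : dot u v = dot v u.
Proof. by apply: eq_bigr => k _; rewrite mulrC. Qed.

Lemma dotDl u v w : dot (u + v) w = dot u w + dot v w.
Proof. by rewrite -big_split; apply: eq_bigr => k _; rewrite mxE mulrDl. Qed.

Lemma dotZl a u w : dot (a *: u) w = a * dot u w.
Proof. by rewrite mulr_sumr; apply: eq_bigr => k _; rewrite mxE mulrA. Qed.

Lemma dotNl u w : dot (- u) w = - dot u w.
Proof. by rewrite -scaleN1r dotZl mulN1r. Qed.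

Lemma dotDr u v w : dot w (u + v) = dot w u + dot w v.
Proof. by rewrite dotC dotDl !(dotC _ w). Qed.

Lemma dotZr a u w : dot w (a *: u) = a * dot w u.
Proof. by rewrite dotC dotZl (dotC _ w). Qed.

Lemma dotNr u w : dot w (- u) = - dot w u.
Proof. by rewrite dotC dotNl (dotC _ w). Qed.

Definition dotE := (dotDl, dotDr, dotNl, dotNr, dotZl, dotZr).

Lemma dot_suml (I : finType) (u : I -> 'rV[R]_d) w :
  dot (\sum_k u k) w = \sum_k dot (u k) w.
Proof.
rewrite exchange_big; apply: eq_bigr => k _.
by rewrite summxE mulr_suml.
Qed.

Lemma dot_ge0 u : 0 <= dot u u.
Proof. by apply: sumr_ge0 => k _; rewrite -expr2 sqr_ge0. Qed.

Lemma dot_eq0 u : dot u u = 0 -> u = 0.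
Proof.
move=> /eqP; rewrite psumr_eq0 => [/allP u0|k _]; last by rewrite -expr2 sqr_ge0.
apply/rowP => k; rewrite mxE.
by have /eqP := u0 k (mem_index_enum k); rewrite -expr2 => /eqP; rewrite sqrf_eq0 => /eqP.
Qed.

Lemma l2norm_sqr u : l2norm u ^+ 2 = dot u u.
Proof. by rewrite sqr_sqrtr ?dot_ge0. Qed.

Lemma dot_amgm u v : 2 * dot u v <= dot u u + dot v v.
Proof. by have := dot_ge0 (u - v); rewrite !dotE (dotC v u); lra. Qed.

(** Here [a + (g - b)] stands for the estimator: [a] and [b] are the gradient
    increments of the sampled component from the minimiser to the iterate and
    to the pivot, and [g] is the full gradient at the pivot.  The last two terms
    are affine in [a - b] and [b], so they are known exactly once averaged over
    the sampled component. *)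
Lemma dot_step_le (h : R) (e a b g : 'rV[R]_d) :
  dot (e - h *: (a + (g - b))) (e - h *: (a + (g - b))) <=
  dot e e - 2 * h * dot g e
    + h ^+ 2 * (2 * dot a a + 2 * dot b b + 2 * dot g g)
    + - (2 * h) * dot (a - b) e + - (4 * h ^+ 2) * dot b g.
Proof.
have := ler_wpM2l (sqr_ge0 h) (dot_amgm a (g - b)).
rewrite !dotE (dotC e a) (dotC e b) (dotC e g) (dotC b a) (dotC g a) (dotC g b).
lra.
Qed.

Lemma smooth_dot L (g : 'rV[R]_d -> R) u v : smooth L g ->
  dot (grad g u - grad g v) (grad g u - grad g v) <=
  L ^+ 2 * dot (u - v) (u - v).
Proof.
move=> [_ /(_ u v)]; rewrite -!l2norm_sqr -exprMn => gL.
rewrite lerXn2r ?nnegrE ?sqrtr_ge0 //.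
by apply: le_trans gL; apply: sqrtr_ge0.
Qed.

End Dot.

(** * Gradients and the averaged update *)

Section Gradient.
Context {R : realType} {d N : nat}.
Variables (f : 'I_N -> 'rV[R]_d -> R) (xs : 'rV[R]_d) (L mu : R).
Hypotheses (N_gt0 : (0 < N)%N) (fS : forall l, smooth L (f l))
  (fRSI : restricted_secant mu (favg f) xs).

Lemma grad_favg y : grad (favg f) y = N%:R^-1 *: \sum_l grad (f l) y.
Proof.
apply/rowP => k; rewrite !mxE summxE.
have df l : derivable (f l) y (delta_mx 0 k).
  by apply: diff_derivable; case: (fS l).
have -> : favg f = N%:R^-1 \*: \sum_l f l.
  by apply/funext => z; rewrite /favg /= fct_sumE.
rewrite deriveZ; last exact: derivable_sum.
by rewrite derive_sum //; congr (_ * _); apply: eq_bigr => l _; rewrite !mxE.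
Qed.

Lemma dot_grad_favg y w :
  dot (grad (favg f) y) w = N%:R^-1 * \sum_l dot (grad (f l) y) w.
Proof. by rewrite grad_favg dotZl dot_suml. Qed.

Lemma mean_cst (a : R) : N%:R^-1 * \sum_(l < N) a = a.
Proof.
by rewrite sumr_const card_ord -(mulr_natl a) mulKf // pnatr_eq0 -lt0n.
Qed.

Lemma mean_le (a b : 'I_N -> R) : (forall l, a l <= b l) ->
  N%:R^-1 * \sum_l a l <= N%:R^-1 * \sum_l b l.
Proof. by move=> ab; rewrite ler_wpM2l ?invr_ge0 // ler_sum. Qed.

(** Test the gradient [g] at [xs] on the point [y = xs - t g].  Restricted
    secant at [y] makes [<grad f(y), g>] nonpositive, whereas smoothness keeps
    [grad f(y)] within [L t |g|] of [g]; for [L t < 1] both hold only if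
    [g = 0]. *)
Lemma grad_favg_xs : grad (favg f) xs = 0.
Proof.
set g := grad (favg f) xs; apply: dot_eq0.
(* Any positive t with (L t)^2 < 1 would do. *)
set t : R := (1 + L ^+ 2)^-1.
have tE : t * (1 + L ^+ 2) = 1 by rewrite mulVf //; have := sqr_ge0 L; lra.
have t_gt0 : 0 < t by rewrite invr_gt0; have := sqr_ge0 L; lra.
pose y := xs - t *: g.
have yg : dot (grad (favg f) y) g <= 0.
  have [_ mu0 /(_ y)] := fRSI; rewrite l2norm_sqr => ry.
  have : 0 <= dot (grad (favg f) y) (y - xs).
    by apply: le_trans ry; rewrite mulr_ge0 ?dot_ge0 // divr_ge0 // ltW.
  have -> : y - xs = - (t *: g) by rewrite /y addrC addKr.
  by rewrite dotNr dotZr oppr_ge0 pmulr_rle0.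
have gy : dot g g - dot (grad (favg f) y) g <= (L ^+ 2 * t ^+ 2 + 1) / 2 * dot g g.
  rewrite -[leRHS]mean_cst; set rhs := leRHS.
  rewrite /g !dot_grad_favg -mulrBr -sumrB {}/rhs -/g.
  apply: mean_le => l; rewrite -dotNl -dotDl.
  have := dot_amgm (grad (f l) xs - grad (f l) y) g.
  have := smooth_dot _ _ xs y (fS l).
  have -> : xs - y = t *: g by rewrite /y subKr.
  by rewrite dotZl dotZr; lra.
have g0 := dot_ge0 g.
have Lt : L ^+ 2 * t ^+ 2 < 1.
  have -> : L ^+ 2 * t ^+ 2 = t * (t * (1 + L ^+ 2)) - t ^+ 2 by ring.
  by rewrite tE; nra.
by nra.
Qed.

Lemma mean_affine (c0 c1 c2 : R) (a b : 'I_N -> R) :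
  N%:R^-1 * \sum_l (c0 + c1 * a l + c2 * b l) =
  c0 + c1 * (N%:R^-1 * \sum_l a l) + c2 * (N%:R^-1 * \sum_l b l).
Proof.
rewrite !big_split /= -!mulr_sumr !mulrDr mean_cst.
by rewrite !(mulrCA N%:R^-1).
Qed.

(** Centring the pivot term at its mean [grad f(p)] only lowers its second
    moment, so the pivot enters with coefficient [2 * L ^+ 2 * h ^+ 2], the same
    as the iterate; the gain, a multiple of [|grad f(p)|^2], is discarded. *)
Lemma mean_update_le h y p : 0 <= h ->
  N%:R^-1 * \sum_l l2norm (y - h *: vr_estimator f l y p - xs) ^+ 2
    + h * (mu - 2 * L ^+ 2 * h) * l2norm (y - xs) ^+ 2 <=
  l2norm (y - xs) ^+ 2 + 2 * L ^+ 2 * h ^+ 2 * l2norm (p - xs) ^+ 2.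
Proof.
move=> h0; have [_ _ /(_ y)] := fRSI; rewrite !l2norm_sqr => yRSI.
under eq_bigr do rewrite l2norm_sqr.
set e := y - xs in yRSI *; set q := p - xs; set gp := grad (favg f) p.
set gy := grad (favg f) y in yRSI *.
pose b l := grad (f l) p - grad (f l) xs.
have step l :
    dot (y - h *: vr_estimator f l y p - xs) (y - h *: vr_estimator f l y p - xs) <=
    dot e e - 2 * h * dot gp e
      + h ^+ 2 * (2 * L ^+ 2 * dot e e + 2 * L ^+ 2 * dot q q + 2 * dot gp gp)
    + (- (2 * h)) * dot (grad (f l) y - grad (f l) p) e
    + (- (4 * h ^+ 2)) * dot (b l) gp.
  pose a := grad (f l) y - grad (f l) xs.
  have aL : dot a a <= L ^+ 2 * dot e e by exact: smooth_dot.
  have bL : dot (b l) (b l) <= L ^+ 2 * dot q q by exact: smooth_dot.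
  have vE : vr_estimator f l y p = a + (gp - b l).
    by rewrite /a /b opprB [RHS]addrCA subrKA addrC.
  have -> : y - h *: vr_estimator f l y p - xs = e - h *: (a + (gp - b l)).
    by rewrite vE addrAC.
  have -> : grad (f l) y - grad (f l) p = a - b l by rewrite /a /b opprB subrKA.
  apply: le_trans (dot_step_le _ _ _ _ _) _.
  have := ler_wpM2l (sqr_ge0 h) aL; have := ler_wpM2l (sqr_ge0 h) bL.
  lra.
apply: le_trans (_ : _ <= _ + h * (mu - 2 * L ^+ 2 * h) * dot e e) _.
  by rewrite lerD2r; apply: mean_le; exact: step.
rewrite mean_affine.
have -> : N%:R^-1 * \sum_l dot (grad (f l) y - grad (f l) p) e = dot gy e - dot gp e.
  under eq_bigr do rewrite dotDl dotNl.
  by rewrite sumrB mulrBr -!dot_grad_favg.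
have -> : N%:R^-1 * \sum_l dot (b l) gp = dot gp gp.
  under eq_bigr do rewrite dotDl dotNl.
  by rewrite sumrB mulrBr -!dot_grad_favg grad_favg_xs -(scale0r gp)
    dotZl mul0r subr0.
have := ler_wpM2l h0 yRSI.
have := mulr_ge0 (sqr_ge0 h) (dot_ge0 gp).
lra.
Qed.

End Gradient.

(** * Random variables with finitely many values *)

Section FiniteExpectation.
Context {dT : measure_display} {T : measurableType dT} {R : realType}.
Variable P : probability T R.

Lemma fin_rv_decomp {V : finType} (Z : T -> V) (g : V -> R) w :
  g (Z w) = \sum_v g v * \1_(Z @^-1` [set v]) w.
Proof.
rewrite (bigD1 (Z w)) //= indicE mem_set // mulr1 big1 ?addr0 // => v vZ.
by rewrite indicE memNset ?mulr0 //= => /esym /eqP; apply/negP.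
Qed.

Lemma measurable_fin_rv {V : finType} (Z : T -> V) (g : V -> R) :
  (forall v, measurable (Z @^-1` [set v])) ->
  measurable_fun setT (fun w => g (Z w)).
Proof.
move=> mZ; under eq_fun do rewrite fin_rv_decomp.
by apply: measurable_sum => v; apply: measurable_funM.
Qed.

Lemma expectation_fin_rv {V : finType} (Z : T -> V) (g : V -> R) :
  (forall v, measurable (Z @^-1` [set v])) -> (forall v, 0 <= g v) ->
  ('E_P[fun w => g (Z w)] = \sum_v (g v)%:E * P (Z @^-1` [set v]))%E.
Proof.
move=> mZ g0; rewrite unlock.
under eq_integral do rewrite fin_rv_decomp -sumEFin.
rewrite ge0_integral_sum //.
- apply: eq_bigr => v _; under eq_integral do rewrite EFinM.
  rewrite ge0_integralZl_EFin //.
  + by rewrite integral_indic // setIT.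
  + exact/measurable_EFinP/measurable_indic.
- move=> v; exact/measurable_EFinP/measurable_funM.
- by move=> v w _; rewrite lee_fin mulr_ge0.
Qed.

Lemma expectation_fin_rv_fin_num {V : finType} (Z : T -> V) (g : V -> R) :
  (forall v, measurable (Z @^-1` [set v])) -> (forall v, 0 <= g v) ->
  'E_P[fun w => g (Z w)]%E \is a fin_num.
Proof.
move=> mZ g0; rewrite expectation_fin_rv //; apply/sum_fin_numP => v _ _.
by rewrite fin_numM // fin_num_measure.
Qed.

Lemma expectation_ge0_lin (X Y : T -> R) (k : R) :
  measurable_fun setT X -> measurable_fun setT Y ->
  (forall w, 0 <= X w) -> (forall w, 0 <= Y w) -> 0 <= k ->
  ('E_P[fun w => (X w + k * Y w)%R] = 'E_P[X] + k%:E * 'E_P[Y])%E.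
Proof.
move=> /measurable_EFinP mX /measurable_EFinP mY X0 Y0 k0; rewrite unlock.
under eq_integral do rewrite EFinD EFinM.
rewrite ge0_integralD //.
- rewrite ge0_integralZl_EFin // => w _; exact: Y0.
- by move=> w _; exact: X0.
- by move=> w _; rewrite -EFinM lee_fin mulr_ge0.
- exact: measurable_funeM.
Qed.

Lemma expectation_ge0_sum {U : finType} (X : U -> T -> R) (k : R) :
  (forall a, measurable_fun setT (X a)) -> (forall a w, 0 <= X a w) -> 0 <= k ->
  ('E_P[fun w => (k * \sum_a X a w)%R] = k%:E * \sum_a 'E_P[X a])%E.
Proof.
move=> mX X0 k0.
have mE a : measurable_fun setT (fun w => (X a w)%:E).
  exact/measurable_EFinP/mX.
rewrite unlock -ge0_integral_sum // => [|a w _]; last by rewrite lee_fin.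
rewrite -ge0_integralZl_EFin //.
- by apply: eq_integral => w _; rewrite EFinM sumEFin.
- by move=> w _; apply: sume_ge0 => a _; rewrite lee_fin.
- exact: emeasurable_sum.
Qed.

(** Averaging out an independent uniform draw, in the only form needed: the
    joint law of [(Z, u)] is a product, so the expectation is a double finite
    sum whose inner sum is the mean over [u]. *)
Lemma expectation_indep_uniform {V U : finType} (Z : T -> V) (u : T -> U)
    (g : V -> U -> R) :
  (forall v, measurable (Z @^-1` [set v])) ->
  (forall a, measurable (u @^-1` [set a])) ->
  (forall v a, P (Z @^-1` [set v] `&` u @^-1` [set a]) =
    (P (Z @^-1` [set v]) * P (u @^-1` [set a]))%E) ->
  uniformly_distributed P u ->
  (forall v a, 0 <= g v a) ->
  ('E_P[fun w => g (Z w) (u w)] =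
   'E_P[fun w => (#|U|%:R^-1 * \sum_a g (Z w) a)%R])%E.
Proof.
move=> mZ mu indep unif g0.
have Zu v a : (fun w => (Z w, u w)) @^-1` [set (v, a)] =
    Z @^-1` [set v] `&` u @^-1` [set a].
  by apply/seteqP; split=> w /= [-> ->].
rewrite (@expectation_fin_rv _ (fun w => (Z w, u w)) (fun p => g p.1 p.2)) //;
  last by case=> v a; rewrite Zu; apply: measurableI.
rewrite (@expectation_fin_rv _ Z (fun v => #|U|%:R^-1 * \sum_a g v a)) //;
  last by move=> v; rewrite mulr_ge0 ?invr_ge0 ?sumr_ge0.
transitivity (\sum_p (g p.1 p.2)%:E *
    P (Z @^-1` [set p.1] `&` u @^-1` [set p.2]))%E.
  by apply: eq_bigr => -[v a] _; rewrite Zu.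
rewrite -(pair_bigA _ (fun v a =>
  ((g v a)%:E * P (Z @^-1` [set v] `&` u @^-1` [set a]))%E)) /=.
apply: eq_bigr => v _; rewrite mulr_sumr -sumEFin ge0_sume_distrl; last first.
  by move=> a _; rewrite lee_fin mulr_ge0 ?invr_ge0.
by apply: eq_bigr => a _; rewrite indep unif EFinM muleA muleC muleA.
Qed.

(** A cylinder over [J] and an event of a further index [s0] together form a
    cylinder over [s0 |` J], to which the product rule applies. *)
Lemma mutually_independent_fresh {I : choiceType} (E : I -> set (set T))
    (J : {fset I}) (s0 : I) (A : I -> set T) (B : set T) :
  mutually_independent P E -> s0 \notin J -> E s0 B ->
  (forall s, E s (A s)) ->
  P (\bigcap_(s in [set` J]) A s `&` B) = (P (\bigcap_(s in [set` J]) A s) * P B)%E.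
Proof.
move=> indep s0J EB EA.
(* The cylinder over the enlarged index set takes B in coordinate s0. *)
pose A' s := if s == s0 then B else A s.
have EA' s : E s (A' s) by rewrite /A'; case: eqP => [->|].
have A'J s : s \in J -> A' s = A s.
  by rewrite /A'; case: eqP => [->|//]; rewrite (negPf s0J).
have -> : \bigcap_(s in [set` J]) A s `&` B =
    \bigcap_(s in [set` (s0 |` J)%fset]) A' s.
  apply/seteqP; split=> [w [AJ Bw] s /= /fset1UP [->|sJ]|w AJ].
  - by rewrite /A' eqxx.
  - by rewrite A'J //; apply: AJ.
  - split=> [s /= sJ|]; first by rewrite -A'J //; apply: AJ; rewrite /= in_fset1U sJ orbT.
    by have := AJ s0; rewrite /A' eqxx; apply; rewrite /= in_fset1U eqxx.
rewrite !indep // big_fsetU1 //= {1}/A' eqxx muleC; congr (_ * _)%E.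
by apply: eq_big_seq => s /A'J ->.
Qed.

End FiniteExpectation.

(** * Averaging over a fresh draw *)

Section Sampling.
Context {dT : measure_display} {T : measurableType dT} {R : realType}.
Context {P : probability T R} {N m : nat}.
Context {i : nat -> T -> 'I_N} {r : nat -> T -> 'I_m}.
Hypothesis sampling : svrg_sampling P i r.

(** Measurability with respect to the first [n] index draws and the first [q]
    jump draws, stated pathwise. *)
Definition determined {A : Type} (n q : nat) (X : T -> A) :=
  forall w w', (forall l, (l < n)%N -> i l w = i l w') ->
    (forall l, (l < q)%N -> r l w = r l w') -> X w = X w'.

Definition history n q (w : T) : {ffun 'I_n -> 'I_N} * {ffun 'I_q -> 'I_m} :=
  ([ffun l : 'I_n => i l w], [ffun l : 'I_q => r l w]).

Definition history_index n q : {fset nat + nat} :=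
  seq_fset tt (map inl (iota 0 n) ++ map inr (iota 0 q)).

Lemma mem_history_index n q s :
  (s \in history_index n q) =
  match s with inl l => l < n | inr l => l < q end%N.
Proof.
rewrite seq_fsetE mem_cat; case: s => l.
  rewrite mem_map ?mem_iota ?add0n; last by move=> ? ? [].
  by rewrite [X in _ || X](_ : _ = false) ?orbF //; apply/mapP => -[].
rewrite orbC mem_map ?mem_iota ?add0n; last by move=> ? ? [].
by rewrite [X in _ || X](_ : _ = false) ?orbF //; apply/mapP => -[].
Qed.

Definition draw_sigma (s : nat + nat) : set (set T) :=
  match s with
  | inl k => generated_sigma (i k)
  | inr j => generated_sigma (r j)
  end.

(** The events whose intersection over [history_index n q] is
    [history n q w = v].  The factors outside that index set are the full space,
    since independence is stated for families over all indices. *)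
Definition history_factor n q (v : {ffun 'I_n -> 'I_N} * {ffun 'I_q -> 'I_m})
    (s : nat + nat) : set T :=
  match s with
  | inl l => [set w | forall lt_ln : (l < n)%N, i l w = v.1 (Ordinal lt_ln)]
  | inr l => [set w | forall lt_lq : (l < q)%N, r l w = v.2 (Ordinal lt_lq)]
  end.

Lemma draw_sigma_factor n q v s : draw_sigma s (history_factor n q v s).
Proof.
case: s => l /=.
  by exists [set a | forall lt_ln : (l < n)%N, a = v.1 (Ordinal lt_ln)]; rewrite ?setTI.
by exists [set a | forall lt_lq : (l < q)%N, a = v.2 (Ordinal lt_lq)]; rewrite ?setTI.
Qed.

Lemma draw_sigma_measurable s : draw_sigma s `<=` measurable.
Proof. by have [mi mr _] := sampling; case: s => l; [case: (mi l)|case: (mr l)]. Qed.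

Lemma history_preimage n q v :
  history n q @^-1` [set v] =
  \bigcap_(s in [set` history_index n q]) history_factor n q v s.
Proof.
apply/seteqP; split=> [w /= <- [] l _ /= lt|w wv].
- by rewrite ffunE.
- by rewrite ffunE.
case: v wv => v1 v2 wv; congr pair; apply/ffunP => l; rewrite ffunE.
  have := wv (inl (nat_of_ord l)); rewrite /= mem_history_index => /(_ (ltn_ord l) (ltn_ord l)) ->.
  by congr (v1 _); apply: val_inj.
have := wv (inr (nat_of_ord l)); rewrite /= mem_history_index => /(_ (ltn_ord l) (ltn_ord l)) ->.
by congr (v2 _); apply: val_inj.
Qed.

Lemma measurable_history n q v : measurable (history n q @^-1` [set v]).
Proof.
rewrite history_preimage; apply: fin_bigcap_measurable => // s _.
by apply: draw_sigma_measurable; apply: draw_sigma_factor.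
Qed.

(** The factorisation goes through a representative outcome of each history
    instead of a value of [X], so that the pointwise properties of [X], such as
    nonnegativity, pass to the factor even on histories that never occur. *)
Lemma determined_factor {A : Type} n q (X : T -> A) : determined n q X ->
  exists rep : {ffun 'I_n -> 'I_N} * {ffun 'I_q -> 'I_m} -> T,
    forall w, X w = X (rep (history n q w)).
Proof.
move=> Xdet; exists (fun v => xget point [set w | history n q w = v]) => w /=.
case: xgetP => [w' _ /= hist|/(_ w) []//]; apply: (Xdet w w') => l lt.
  by have /ffunP/(_ (Ordinal lt)) := congr1 fst hist; rewrite !ffunE => ->.
by have /ffunP/(_ (Ordinal lt)) := congr1 snd hist; rewrite !ffunE => ->.
Qed.

Lemma measurable_determined n q (X : T -> R) :
  determined n q X -> measurable_fun setT X.
Proof.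
move=> /determined_factor [rep Xrep].
rewrite (_ : X = fun w => X (rep (history n q w))); last exact/funext.
apply: (measurable_fin_rv (history n q) (fun v => X (rep v))) => v.
exact: measurable_history.
Qed.

Lemma expectation_determined_fin_num n q (X : T -> R) :
  determined n q X -> (forall w, 0 <= X w) -> 'E_P[X]%E \is a fin_num.
Proof.
move=> /determined_factor [rep Xrep] X0.
rewrite (_ : X = fun w => X (rep (history n q w))); last exact/funext.
apply: (expectation_fin_rv_fin_num P (history n q) (fun v => X (rep v))) => // v.
exact: measurable_history.
Qed.

Lemma determined_mono {A : Type} n q n' q' (X : T -> A) :
  (n <= n')%N -> (q <= q')%N -> determined n q X -> determined n' q' X.
Proof.
move=> nn qq Xdet w w' wi wr; apply: Xdet => l lt.
  by apply: wi; apply: leq_trans nn.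
by apply: wr; apply: leq_trans qq.
Qed.

(** Plays the part of conditioning on the past: a draw [s0] outside the history
    on which [G] depends may be replaced by its mean inside the expectation. *)
Lemma expectation_fresh_draw {U : finType} (u : T -> U) s0 n q (G : T -> U -> R) :
  s0 \notin history_index n q -> generated_sigma u = draw_sigma s0 ->
  uniformly_distributed P u -> (forall w a, 0 <= G w a) ->
  determined n q G ->
  ('E_P[fun w => G w (u w)] =
   'E_P[fun w => (#|U|%:R^-1 * \sum_a G w a)%R])%E.
Proof.
move=> s0J us0 unif G0 /determined_factor [rep Grep].
have su a : generated_sigma u (u @^-1` [set a]).
  by exists [set a]; rewrite ?setTI.
have [_ _ indep] := sampling.
transitivity ('E_P[fun w => G (rep (history n q w)) (u w)])%E.
  by congr expectation; apply/funext => w; rewrite Grep.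
rewrite (expectation_indep_uniform P _ u (fun v => G (rep v))) //.
- by congr expectation; apply/funext => w; rewrite -Grep.
- exact: measurable_history.
- by move=> a; apply: (draw_sigma_measurable s0); rewrite -us0.
- move=> v a; rewrite history_preimage.
  apply: (@mutually_independent_fresh _ _ _ _ _ draw_sigma _ s0) => //.
  + by rewrite -us0.
  + by move=> s; apply: draw_sigma_factor.
Qed.

End Sampling.

Arguments determined {dT T N m} i r {A} n q X.

(** * The recursion within an epoch *)

Section Trajectory.
Context {R : realType} {d N m : nat} {T : Type}.
Context {f : 'I_N -> 'rV[R]_d -> R} {h : R} {x0 : 'rV[R]_d}.
Context {i : nat -> T -> 'I_N} {r : nat -> T -> 'I_m} {x : nat -> T -> 'rV[R]_d}.
Hypothesis process : svrg_process f h x0 i r x.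

Lemma stalenessE j t : (t < m)%N -> staleness m (j * m + t) = t.
Proof.
move=> tm; have m_gt0 : (0 < m)%N by apply: leq_ltn_trans tm.
by rewrite /staleness divnMDl // divn_small // addn0 mulnC addKn.
Qed.

Lemma svrg_step j t w : (t.+1 < m)%N ->
  x (j * m + t.+1) w =
  x (j * m + t) w -
    h *: vr_estimator f (i (j * m + t) w) (x (j * m + t) w) (x (j * m) w).
Proof.
move=> tm; have [_ step _] := process; rewrite addnS step.
  by rewrite stalenessE ?addnK // ltnW.
by rewrite -addnS dvdn_addr ?dvdn_mull // gtnNdvd.
Qed.

End Trajectory.

(** * Contraction over one epoch *)

Section Contraction.
Context {R : realType} {d N m : nat}.
Context {f : 'I_N -> 'rV[R]_d -> R} {xs x0 : 'rV[R]_d} {L mu h : R}.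
Context {dT : measure_display} {T : measurableType dT} {P : probability T R}.
Context {i : nat -> T -> 'I_N} {r : nat -> T -> 'I_m} {x : nat -> T -> 'rV[R]_d}.
Hypotheses (N_gt0 : (0 < N)%N) (m_gt0 : (0 < m)%N).
Hypotheses (fS : forall l, smooth L (f l))
  (fRSI : restricted_secant mu (favg f) xs).
Hypotheses (h_gt0 : 0 < h) (h_small : 2 * L ^+ 2 * h < mu).
Hypotheses (sampling : svrg_sampling P i r)
  (process : svrg_process f h x0 i r x).

(** During epoch [j] the jump draw [r j] has not been used yet, and the index
    draw of iteration [j * m + t] is first used by the next iterate; both are
    therefore fresh for [x (j * m + t)]. *)
Lemma iterate_determined : forall j t, (t < m)%N ->
  determined i r (j * m + t) j (x (j * m + t)).
Proof.
have [init _ jump] := process.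
have within j t : (t < m)%N -> determined i r (j * m) j (x (j * m)%N) ->
    determined i r (j * m + t) j (x (j * m + t)%N).
  move=> tm pivot; elim: t tm => [|t IHt] tm w w' wi wr.
    by rewrite addn0 in wi *; exact: pivot.
  have lt_wi l n : (n <= j * m + t.+1)%N -> (l < n)%N -> i l w = i l w'.
    by move=> le lt; apply: wi; apply: leq_trans lt le.
  have pE : x (j * m)%N w = x (j * m)%N w'.
    by apply: pivot => // l; apply: lt_wi; rewrite leq_addr.
  have tE : x (j * m + t)%N w = x (j * m + t)%N w'.
    by apply: (IHt (ltnW tm)) => // l; apply: lt_wi; rewrite leq_add2l.
  have iE : i (j * m + t)%N w = i (j * m + t)%N w'.
    by apply: (lt_wi _ (j * m + t).+1); rewrite // addnS.
  by rewrite (svrg_step process _ _ w tm) (svrg_step process _ _ w' tm) pE tE iE.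
elim=> [|j IHj] t tm; apply: within => // w w' wi wr; first by rewrite !init.
rewrite !jump (wr j) //.
apply: (IHj _ (ltn_ord _)) => l lt; last by apply: wr; apply: ltnW.
by apply: wi; apply: leq_trans lt _; rewrite mulSn addnC leq_add2r ltnW.
Qed.

Let dist k w : R := l2norm (x k w - xs) ^+ 2.
Let Edist k : R := fine 'E_P[dist k]%E.
Let c : R := h * (mu - 2 * L ^+ 2 * h).
Let b : R := 2 * L ^+ 2 * h ^+ 2.

Let dist_ge0 k w : 0 <= dist k w. Proof. exact: sqr_ge0. Qed.

Let c_gt0 : 0 < c. Proof. by rewrite mulr_gt0 // subr_gt0. Qed.

Let b_ge0 : 0 <= b.
Proof. by rewrite /b; have := mulr_ge0 (sqr_ge0 L) (sqr_ge0 h); lra. Qed.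

Let dist_determined j t : (t < m)%N ->
  determined i r (j * m + t) j (dist (j * m + t)).
Proof. by move=> tm w w' wi wr; rewrite /dist (iterate_determined _ _ tm w w'). Qed.

Let EdistE j t : (t < m)%N ->
  'E_P[dist (j * m + t)]%E = (Edist (j * m + t))%:E.
Proof.
move=> tm; rewrite fineK //.
by apply: (expectation_determined_fin_num sampling _ _ _ (dist_determined j t tm)).
Qed.

(* The squared distance after the update by component a.  At t = m - 1 this
   is the distance of the discarded point, which is no iterate. *)
Let next j t w (a : 'I_N) : R :=
  l2norm (x (j * m + t)%N w
    - h *: vr_estimator f a (x (j * m + t)%N w) (x (j * m)%N w) - xs) ^+ 2.

Lemma pivot_determined j : determined i r (j * m) j (x (j * m)%N).
Proof. by have := iterate_determined j 0 m_gt0; rewrite addn0. Qed.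

Let dist_pivot_determined j : determined i r (j * m) j (dist (j * m)%N).
Proof. by have := dist_determined j 0 m_gt0; rewrite addn0. Qed.

Let EdistE0 j : 'E_P[dist (j * m)%N]%E = (Edist (j * m)%N)%:E.
Proof. by have := EdistE j 0 m_gt0; rewrite addn0. Qed.

Lemma expected_step j t : (t < m)%N ->
  ('E_P[fun w => next j t w (i (j * m + t)%N w)] + (c * Edist (j * m + t))%:E <=
   (Edist (j * m + t) + b * Edist (j * m)%N)%:E)%E.
Proof.
move=> tm; have pdet := determined_mono _ _ _ _ _ (leq_addr t (j * m)) (leqnn j)
  (pivot_determined j).
have tdet := iterate_determined j t tm.
have nextdet : determined i r (j * m + t) j (next j t).
  by move=> w w' wi wr; rewrite /next (pdet w w' wi wr) (tdet w w' wi wr).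
have next_ge0 w a : 0 <= next j t w a by apply: sqr_ge0.
pose mnext w := #|'I_N|%:R^-1 * \sum_a next j t w a.
have mnextdet : determined i r (j * m + t) j mnext.
  by move=> w w' wi wr; rewrite /mnext (nextdet w w' wi wr).
have mnext_ge0 w : 0 <= mnext w by rewrite mulr_ge0 ?invr_ge0 ?sumr_ge0.
have [unif _ _] := sampling.
rewrite (expectation_fresh_draw sampling _ (inl (j * m + t)%N) _ _ _ _ _
  (unif _).2 next_ge0 nextdet) //; last by rewrite mem_history_index ltnn.
have mdist := measurable_determined sampling _ _ _ (dist_determined j t tm).
have mpivot := measurable_determined sampling _ _ _ (dist_pivot_determined j).
have mmnext := measurable_determined sampling _ _ _ mnextdet.
have -> : (Edist (j * m + t) + b * Edist (j * m)%N)%:E =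
    'E_P[fun w => (dist (j * m + t) w + b * dist (j * m) w)%R]%E.
  by rewrite expectation_ge0_lin // EdistE // EdistE0.
have -> : ((c * Edist (j * m + t))%:E = c%:E * 'E_P[dist (j * m + t)])%E.
  by rewrite EdistE.
rewrite -(expectation_ge0_lin _ mnext) ?(ltW c_gt0) //.
apply: expectation_le.
- by apply: measurable_funD => //; apply: measurable_funM.
- by apply: measurable_funD => //; apply: measurable_funM.
- by move=> w; rewrite addr_ge0 // mulr_ge0 // ltW.
- by move=> w; rewrite addr_ge0 // mulr_ge0.
- apply: aeW => w; rewrite /mnext card_ord.
  exact: (mean_update_le _ _ _ _ N_gt0 fS fRSI _ _ _ (ltW h_gt0)).
Qed.

Lemma epoch_telescope j t : (t < m)%N ->
  Edist (j * m + t) + c * \sum_(l < t) Edist (j * m + l) <=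
  (1 + b * t%:R) * Edist (j * m).
Proof.
elim: t => [|t IHt] tm; first by rewrite big_ord0 addn0 !mulr0 !addr0 mul1r.
have := expected_step j t (ltnW tm).
have -> : (fun w => next j t w (i (j * m + t)%N w)) = dist (j * m + t.+1)%N.
  by apply/funext => w; rewrite /dist (svrg_step process _ _ w tm).
rewrite EdistE // lee_fin big_ord_recr /= mulrDr -natr1 => step.
by have := IHt (ltnW tm); lra.
Qed.

(** The last summand comes from the discarded update: its expected squared
    distance is dropped by nonnegativity instead of being identified with that
    of a later iterate. *)
Lemma epoch_sum j :
  c * \sum_(l < m) Edist (j * m + l) <= (1 + b * m%:R) * Edist (j * m).
Proof.
have [t mE] : exists t, m = t.+1 by exists m.-1; rewrite prednK.
have tm : (t < m)%N by rewrite mE.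
have lastE : ((c * Edist (j * m + t))%:E <=
    (Edist (j * m + t) + b * Edist (j * m)%N)%:E)%E.
  apply: le_trans (expected_step j t tm); apply: leeDr.
  by apply: expectation_ge0 => w; apply: sqr_ge0.
rewrite lee_fin in lastE; have := epoch_telescope j t tm.
have -> : \sum_(l < m) Edist (j * m + l) =
    \sum_(l < t) Edist (j * m + l) + Edist (j * m + t).
  by rewrite -(big_mkord xpredT (fun l => Edist (j * m + l))) mE
    big_nat_recr //= big_mkord.
have -> : m%:R = t%:R + 1 :> R by rewrite mE natr1.
by lra.
Qed.

Lemma expected_jump j :
  'E_P[dist (j.+1 * m)]%E = (m%:R^-1 * \sum_(l < m) Edist (j * m + l))%:E.
Proof.
have [_ _ jump] := process; have [_ unif _] := sampling.
have -> : dist (j.+1 * m) = fun w => dist (j * m + r j w) w.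
  by apply/funext => w; rewrite /dist jump.
have dist_det : determined i r (j.+1 * m) j (fun w (a : 'I_m) => dist (j * m + a) w).
  move=> w w' wi wr; apply/funext => a.
  apply: (dist_determined _ _ (ltn_ord a)) => // l lt; apply: wi.
  by apply: leq_trans lt _; rewrite mulSn addnC leq_add2r ltnW.
rewrite (expectation_fresh_draw sampling _ (inr j) _ _
  (fun w (a : 'I_m) => dist (j * m + a) w) _ _ (unif _).2 _ dist_det) //;
  last by rewrite mem_history_index ltnn.
rewrite card_ord (expectation_ge0_sum P (fun (a : 'I_m) => dist (j * m + a))) //;
  last by move=> a; apply: (measurable_determined sampling _ _ _ (dist_determined j a _)).
by rewrite EFinM -sumEFin; congr (_ * _)%E; apply: eq_bigr => a _; rewrite EdistE.
Qed.

Lemma epoch_contraction j :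
  ('E_P[fun w => (l2norm (x (j.+1 * m) w - xs) ^+ 2)%R] <=
   ((1 + 2 * L ^+ 2 * h ^+ 2 * m%:R) / (h * (mu - 2 * L ^+ 2 * h) * m%:R))%:E *
   'E_P[fun w => (l2norm (x (j * m) w - xs) ^+ 2)%R])%E.
Proof.
rewrite -/b -/c -/(dist (j.+1 * m)) -/(dist (j * m)) expected_jump EdistE0.
rewrite -EFinM lee_fin.
have m0 : 0 < m%:R :> R by rewrite ltr0n.
rewrite mulrAC ler_pdivlMr; last exact: mulr_gt0.
apply: le_trans (epoch_sum j).
by rewrite (mulrC c m%:R) mulrACA mulVf ?gt_eqF // mul1r mulrC.
Qed.

End Contraction.

(** * Geometric convergence *)

Theorem theoremE4 (R : realType) (d N m : nat)
    (f : 'I_N -> 'rV[R]_d -> R) (xs x0 : 'rV[R]_d) (L mu h : R)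
    (dT : measure_display) (T : measurableType dT) (P : probability T R)
    (i : nat -> T -> 'I_N) (r : nat -> T -> 'I_m)
    (x : nat -> T -> 'rV[R]_d)
    (hN : (0 < N)%N) (hm : (0 < m)%N)
    (hC1 : forall l, continuously_differentiable (f l))
    (hsmooth : forall l, smooth L (f l))
    (hmin : global_minimizer (favg f) xs)
    (hRSI : restricted_secant mu (favg f) xs)
    (hh : 0 < h) (hstep : 2 * L ^+ 2 * h < mu)
    (hsampling : svrg_sampling P i r)
    (hx : svrg_process f h x0 i r x) :
  forall j : nat,
    ('E_P[fun w : T => (l2norm (x (j * m)%N w - xs) ^+ 2)%R] <=
     (((1 + 2 * L ^+ 2 * h ^+ 2 * m%:R) /
       (h * m%:R * (mu - 2 * L ^+ 2 * h))) ^+ j *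
      l2norm (x0 - xs) ^+ 2)%:E)%E.
Proof.
elim=> [|j IHj].
  have [init _ _] := hx.
  rewrite expr0 mul1r (_ : (fun w : T => _) = cst (l2norm (x0 - xs) ^+ 2)).
    by rewrite expectation_cst.
  by apply/funext => w; rewrite mul0n init.
set rho := _ / _ in IHj *; rewrite exprS -mulrA EFinM.
have rho_ge0 : 0 <= rho.
  have := mulr_ge0 (sqr_ge0 L) (sqr_ge0 h) => Lh.
  rewrite divr_ge0 ?mulr_ge0 ?ler0n ?(ltW hh) ?subr_ge0 ?(ltW hstep) //.
  by rewrite addr_ge0 // mulr_ge0 // -mulrA mulr_ge0.
have := epoch_contraction hN hm hsmooth hRSI hh hstep hsampling hx j.
rewrite [h * _ * m%:R]mulrAC -/rho => /le_trans; apply.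
by rewrite lee_wpmul2l ?lee_fin.
Qed.
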